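(* For every $\delta > 0$ there exists a constant $L$ such that for all positive integers $s \ge L$ and $k \ge Ls$, \[ r(s,k) \ge \left(\frac{k}{s}\right)^{(1-\delta)s}. \]
   Context: For positive integers $s,k$, the Ramsey number $r(s,k)$ is the minimum integer $n$ such that every graph on $n$ vertices contains a clique of size $s$ or an independent set of size $k$. *)

(* Defs.v *)
From mathcomp Require Import all_boot.
From Stdlib Require Import Reals.
Set Implicit Arguments. Unset Strict Implicit. Unset Printing Implicit Defensive.

Definition simple_graph (n : nat) (E : rel 'I_n) : Prop :=
  symmetric E /\ irreflexive E.

Definition is_clique (n : nat) (E : rel 'I_n) (A : {set 'I_n}) : Prop :=
  forall x y, x \in A -> y \in A -> x != y -> E x y.

Definition is_indep (n : nat) (E : rel 'I_n) (A : {set 'I_n}) : Prop :=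
  forall x y, x \in A -> y \in A -> ~~ E x y.

Definition ramsey_prop (s k n : nat) : Prop :=
  forall E : rel 'I_n, simple_graph E ->
    (exists A : {set 'I_n}, #|A| = s /\ is_clique E A) \/
    (exists A : {set 'I_n}, #|A| = k /\ is_indep E A).

Definition is_ramsey_number (s k n : nat) : Prop :=
  ramsey_prop s k n /\ forall m, ramsey_prop s k m -> n <= m.

(* Main.v *)
(* Let F be the field with q = 2^j elements and m = s - 1. Give each vertex i an
   independent random pair (a_i, b_i) of vectors of F^m with a_i . b_i <> 0, and
   join i < j when a_i . b_j = 0. On a clique the matrix (a_i . b_j) is triangular
   with nonzero diagonal and has rank at most m, so there is no clique of size s.
   An independent set is a sequence with a_i . b_j <> 0 for i < j. Building it one
   pair at a time, let B be the set of vectors b still allowed. By a second moment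
   bound, all but 4 q^2 q^m / |B| choices of a shrink B by a factor 1 - 1/(2q), so
   that a step which does not shrink B can be made in only about 4 q^2 q^m ways out
   of q^(2m), while at most about 2 q j m steps shrink it. Hence for k much larger
   than q j m there are at most q^((1 + o(1)) m k) such sequences of length k, and
   a union bound over the k-tuples of vertices allows about q^((1 - o(1)) m)
   vertices. The theorem follows with q of order (k/s)^(1 - o(1)). *)
Require Import Defs.
From mathcomp Require Import all_boot all_algebra all_field.
From mathcomp Require Import mxabelem zify.
Set Implicit Arguments. Unset Strict Implicit. Unset Printing Implicit Defensive.
Import GRing.Theory.

(** * Two numerical inequalities *)

(** Chebyshev's pointwise inequality without subtraction: if [2 * T < Y], then [Y ^ 2] is at most
    four times the square of [T - Y], and that square is nonnegative otherwise. *)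
Lemma sq_dev (T Y : nat) : 8 * T * Y + (2 * T < Y) * Y ^ 2 <= 4 * T ^ 2 + 4 * Y ^ 2.
Proof.
rewrite -!mulnn; case: ltnP => /= H.
  have [e ->] : exists e, Y = 2 * T + e by exists (Y - 2 * T); lia.
  nia.
case: (leqP T Y) => TY.
  have [e ->] : exists e, Y = T + e by exists (Y - T); lia.
  nia.
have [e ->] : exists e, T = Y + e by exists (T - Y); lia.
nia.
Qed.

(** Bernoulli's inequality. With [x = 2 * q] it says that [2 * q] shrinkings by the factor 1 -
    1/(2q) at least halve a set. *)
Lemma two_mul_pred_exp x : 0 < x -> 2 * x.-1 ^ x <= x ^ x.
Proof.
case: x => // y _ /=.
have bernoulli n : y ^ n * (y + n) <= y * y.+1 ^ n.
  elim: n => [|n IH]; first by rewrite !expn0 addn0 mulnC.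
  rewrite !expnS; move: IH; move: (y ^ n) (y.+1 ^ n) => u v IH.
  by nia.
have [->|y0] := posnP y; first by rewrite exp0n.
rewrite -(leq_pmul2l y0); apply: leq_trans (bernoulli _).
by rewrite mulnCA mulnA mulnC leq_mul2l; lia.
Qed.

(** * Orthogonality counts over a finite field *)

Section FiniteVectorSpace.
Local Open Scope ring_scope.
Variables (F : finFieldType) (m : nat).
Implicit Types (a b c : 'rV[F]_m) (B : {set 'rV[F]_m}).

Local Notation q := #|F|.

Definition dot a b : F := (a *m b^T) 0 0.

Lemma dotE a b : a *m b^T = (dot a b)%:M.
Proof. exact: mx11_scalar. Qed.

Lemma dot_eq0 a b : (dot a b == 0) = (a *m b^T == 0).
Proof.
rewrite dotE; apply/eqP/eqP => [->|]; first by rewrite raddf0.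
by move/matrixP/(_ 0 0); rewrite !mxE eqxx mulr1n.
Qed.

Lemma dot0r a : dot a 0 = 0.
Proof. by rewrite /dot trmx0 mulmx0 mxE. Qed.

Definition orth b : {set 'rV[F]_m} := [set a | dot a b == 0].

Lemma card_left_kernel p (M : 'M[F]_(m, p)) :
  (q ^ \rank M * #|[set a : 'rV[F]_m | a *m M == 0%R]| = q ^ m)%N.
Proof.
have -> : [set a : 'rV[F]_m | a *m M == 0] = rowg (kermx M).
  apply/setP => a; rewrite inE mem_rowg.
  by apply/eqP/sub_kermxP.
by rewrite card_rowg mxrank_ker -expnD subnKC ?rank_leq_row.
Qed.

Lemma card_orth b : b != 0 -> (q * #|orth b| = q ^ m)%N.
Proof.
move=> b0; rewrite -(card_left_kernel b^T) mxrank_tr rank_rV b0 expn1.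
by congr (_ * #|pred_of_set _|)%N; apply/setP => a; rewrite !inE dot_eq0.
Qed.

(** Pairwise independence: for [c] off the line of [b], the two conditions on [a] form a linear
    system of rank 2. *)
Lemma card_orth2 b c :
  b != 0 -> (forall x, c != x *: b) ->
  (q ^ 2 * #|orth b :&: orth c| = q ^ m)%N.
Proof.
move=> b0 cb; have rk : \rank (row_mx b^T c^T) = 2%N.
  rewrite -tr_col_mx mxrank_tr -addsmxE.
  have sb : (b <= b + c)%MS by exact: addsmxSl.
  have le2 : (\rank (b + c) <= 2)%N.
    apply: leq_trans (mxrank_adds_leqif _ _) _.
    by rewrite !rank_rV; case: (b != 0); case: (c != 0).
  apply/eqP; rewrite eqn_leq le2 /= ltnNge; apply/negP => le1.
  have : (b + c <= b)%MS.
    rewrite -(mxrank_leqif_sup sb) eqn_leq mxrankS //=.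
    by apply: leq_trans le1 _; rewrite rank_rV b0.
  rewrite addsmx_sub => /andP[_ /sub_rVP[x ex]].
  by move: (cb x); rewrite ex eqxx.
rewrite -(card_left_kernel (row_mx b^T c^T)) rk.
congr (_ * #|pred_of_set _|)%N; apply/setP => a; rewrite !inE mul_mx_row !dot_eq0.
apply/andP/eqP => [[/eqP -> /eqP ->]|/eqP]; first exact: row_mx0.
by rewrite row_mx_eq0 => /andP[].
Qed.

(** An independent pair contributes exactly [q ^ m]. For fixed [b] at most [q] vectors [c] are
    multiples of [b], each contributing at most [q * q ^ m]. *)
Lemma sum_card_orth2 B :
  0%R \notin B ->
  (\sum_(b in B) \sum_(c in B) q ^ 2 * #|orth b :&: orth c|
   <= #|B| ^ 2 * q ^ m + #|B| * (q ^ 2 * q ^ m))%N.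
Proof.
move=> B0; rewrite -(mulnn #|B|) -mulnA -mulnDr -(sum_nat_const (mem B)).
apply: leq_sum => b Bb.
have b0 : b != 0 by apply: contraNneq B0 => <-.
pose dep c := [exists x, c == x *: b].
rewrite (bigID dep) /= addnC leq_add //.
  rewrite -sum_nat_const [leqRHS](bigID dep) /= addnC.
  apply: leq_trans (leq_addr _ _); apply: leq_sum => c /andP[_ /existsPn cb].
  by rewrite card_orth2.
apply: (@leq_trans (\sum_(c in B | dep c) q * q ^ m)%N).
  apply: leq_sum => c _; rewrite -(card_orth b0) !mulnA mulnn leq_mul2l.
  by rewrite subset_leq_card ?subsetIl ?orbT.
rewrite sum_nat_const -(mulnn q) -mulnA leq_mul2r.
rewrite (leq_trans _ (leq_imset_card (fun x => x *: b) F)) ?orbT //.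
apply: subset_leq_card; apply/subsetP => c /andP[_ /existsP[x /eqP ->]].
exact: imset_f.
Qed.

(** * First and second moments of the section sizes *)

(** The vectors of [B] that are ruled out for later pairs once [a] has been used. *)
Definition section B a := [set b in B | dot a b == 0].

Lemma card_section B a : #|section B a| = (\sum_(b in B) (a \in orth b))%N.
Proof.
rewrite -sum1_card big_mkcond [RHS]big_mkcond.
by apply: eq_bigr => b _; rewrite !inE; case: (b \in B); case: (_ == _).
Qed.

Lemma sum_card_section B :
  0%R \notin B -> (q * \sum_a #|section B a| = #|B| * q ^ m)%N.
Proof.
move=> B0; under eq_bigr do rewrite card_section.
rewrite exchange_big /= -(sum_nat_const (mem B)) big_distrr; apply: eq_bigr => b Bb.
rewrite -(@card_orth b); last by apply: contraNneq B0 => <-.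
by rewrite -[in RHS]sum1_card [in RHS]big_mkcond; congr (_ * _)%N; apply: eq_bigr => a _; case: ifP.
Qed.

Lemma sum_card_section2 B :
  (\sum_a #|section B a| ^ 2
   = \sum_(b in B) \sum_(c in B) #|orth b :&: orth c|)%N.
Proof.
transitivity (\sum_a \sum_(b in B) \sum_(c in B)
                 (a \in orth b) * (a \in orth c))%N.
  apply: eq_bigr => a _; rewrite card_section -mulnn big_distrl /=.
  by apply: eq_bigr => b _; rewrite big_distrr.
rewrite exchange_big; apply: eq_bigr => b _.
rewrite exchange_big; apply: eq_bigr => c _.
rewrite -sum1_card [RHS]big_mkcond; apply: eq_bigr => a _.
by rewrite in_setI; case: (a \in _); case: (a \in _).
Qed.

(** The section is smaller than half of its average size [#|B| / q] (for [B] without zero). *)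
Definition sparse B a := (2 * q * #|section B a| < #|B|)%N.

(** Summing [sq_dev] over all [a] with [T] equal to [q * #|section B a|], the main terms of the two
    moments cancel; what remains comes from proportional pairs. *)
Lemma card_sparse B :
  0%R \notin B -> (#|[set a | sparse B a]| * #|B| <= 4 * q ^ 2 * q ^ m)%N.
Proof.
move=> B0; have [->|/set0Pn[b Bb]] := eqVneq B set0; first by rewrite cards0 muln0.
have Bgt0 : (0 < #|B|)%N by apply/card_gt0P; exists b.
have S1 := sum_card_section B0.
have S2 : (q ^ 2 * \sum_a #|section B a| ^ 2
           <= #|B| ^ 2 * q ^ m + #|B| * (q ^ 2 * q ^ m))%N.
  rewrite sum_card_section2; apply: leq_trans (sum_card_orth2 B0).
  by rewrite big_distrr; apply: leq_sum => c _; rewrite big_distrr.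
have cV : #|{: 'rV[F]_m}| = (q ^ m)%N by rewrite card_mx mul1n.
have : (\sum_a (8 * q * #|B| * #|section B a| + sparse B a * #|B| ^ 2)
        <= \sum_a (4 * q ^ 2 * #|section B a| ^ 2 + 4 * #|B| ^ 2))%N.
  apply: leq_sum => a _; rewrite /sparse.
  move: #|section B a| #|B| => X Y.
  have -> : (8 * q * Y * X = 8 * (q * X) * Y)%N by rewrite !mulnA (mulnAC _ Y).
  have -> : (4 * q ^ 2 * X ^ 2 = 4 * (q * X) ^ 2)%N by rewrite expnMn mulnA.
  rewrite -(mulnA 2%N); move: (q * X)%N => T.
  exact: sq_dev.
rewrite 2!big_split /= -!big_distrr /= -big_distrl /= sum_nat_const.
have -> : (\sum_a sparse B a)%N = #|[set a | sparse B a]|.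
  rewrite -sum1_card [RHS]big_mkcond.
  by apply: eq_bigr => a _; rewrite inE; case: (sparse B a).
rewrite cV; move: S1 S2 Bgt0.
set X1 := (\sum_a _)%N; set X2 := (\sum_a _)%N; move: X1 X2 (q ^ m)%N => X1 X2 Q.
move: #|[set a | sparse B a]| #|B| #|F| => N Y z S1 S2 Y0.
rewrite -(mulnA 8%N) (mulnC z) -(mulnA 8%N) -(mulnA Y) S1 -(mulnA 4%N) => H.
by rewrite -(leq_pmul2r Y0); move: S2 H; rewrite -!mulnn; move: (z * z)%N => t; nia.
Qed.

(** * Counting free sequences *)

Local Notation V := 'rV[F]_m.
Local Notation Q := (q ^ m)%N.

(** Products within a single pair are left unconstrained, so that the two vectors of the head can be
    chosen independently when counting. *)
Definition free_seq B (t : seq (V * V)) : bool :=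
  all (fun x => x.2 \in B) t && pairwise (fun x y => dot x.1 y.2 != 0) t.

Lemma free_seq_cons B x t :
  free_seq B (x :: t) = (x.2 \in B) && free_seq (B :\: section B x.1) t.
Proof.
rewrite /free_seq /= -andbA; congr (_ && _).
rewrite andbA -all_predI; congr (_ && _).
by apply: eq_all => y /=; rewrite !inE; case: (y.2 \in B); rewrite ?andbF ?andbT.
Qed.

Definition free_tuples B k := [set t : k.-tuple (V * V) | free_seq B t].

Lemma card_free_tuples0 B : #|free_tuples B 0| = 1%N.
Proof.
rewrite (_ : free_tuples B 0 = setT) ?cardsT ?card_tuple //.
by apply/setP => t; rewrite !inE tuple0.
Qed.

Lemma card_free_tuplesS B k :
  (#|free_tuples B k.+1| = #|B| * \sum_a #|free_tuples (B :\: section B a) k|)%N.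
Proof.
rewrite -sum1_card (reindex (fun p : (V * V) * k.-tuple (V * V) =>
  cons_tuple p.1 p.2)) /=; last first.
  exists (fun t => (thead t, behead_tuple t)) => [[x t] _|t _] /=.
    by congr pair; apply: val_inj.
  by rewrite [RHS]tuple_eta; apply: val_inj.
under eq_bigl do rewrite inE free_seq_cons.
rewrite -(pair_big_dep (fun x : V * V => x.2 \in B)
  (fun x (t : k.-tuple (V * V)) => free_seq (B :\: section B x.1) t) (fun _ _ => 1%N)) /=.
rewrite -(sum_nat_const (mem B)) [RHS]exchange_big /=.
rewrite -(pair_big xpredT (fun b => b \in B)
  (fun a b => \sum_(t : k.-tuple _ | free_seq (B :\: section B a) t) 1)%N) /=.
apply: eq_bigr => a _; apply: eq_bigr => b _.
by rewrite -sum1_card; apply: eq_bigl => t; rewrite inE.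
Qed.

(* [h] bounds the number of steps that can still shrink [B] before [#|B| <= 1]. *)
Lemma card_free_tuples_le h k B :
  0%R \notin B -> (#|B| * (2 * q).-1 ^ h <= (2 * q) ^ h)%N ->
  (#|free_tuples B k| <= ((4 * q ^ 2 + 1) * Q) ^ k * Q ^ h)%N.
Proof.
have cV : #|{: V}| = Q by rewrite card_mx mul1n.
have q0 : (0 < q)%N by apply/card_gt0P; exists 0.
have Q0 : (0 < Q)%N by rewrite expn_gt0 q0.
elim: k h B => [|k IH] h B B0 Bh.
  by rewrite card_free_tuples0 mul1n expn_gt0 Q0.
rewrite card_free_tuplesS; set K := ((4 * q ^ 2 + 1) * Q)%N in IH *.
have sub a : B :\: section B a \subset B by exact: subsetDl.
have sub0 a : 0%R \notin B :\: section B a.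
  by apply: contra B0; apply/subsetP.
(* With [h = 0] the set [B] has at most one element, so each pair has at most [Q] choices. *)
case: h Bh => [|h] Bh.
  rewrite !expn0 !muln1 in Bh *.
  apply: (@leq_trans (1 * \sum_a K ^ k)%N).
    apply: leq_mul => //; apply: leq_sum => a _.
    have := IH 0%N _ (sub0 a); rewrite !expn0 !muln1; apply.
    exact: leq_trans (subset_leq_card (sub a)) Bh.
  rewrite mul1n sum_nat_const cV expnS leq_mul2r /K mulnDl mul1n.
  by rewrite leq_addl orbT.
(* A non-sparse [a] spends one unit of [h]; a sparse one keeps [h] and costs an extra factor [Q],
   paid for by the rarity of such [a]. *)
have step a : (#|free_tuples (B :\: section B a) k| <=
               K ^ k * Q ^ h + sparse B a * (K ^ k * Q ^ h.+1))%N.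
  have [sp|nsp] := boolP (sparse B a).
    rewrite mul1n (leq_trans _ (leq_addl _ _)) //; apply: IH => //.
    apply: leq_trans Bh; rewrite leq_mul2r; apply/orP; right.
    exact: subset_leq_card.
  rewrite addn0; apply: IH => //.
  have SB : #|section B a| + #|B :\: section B a| = #|B|.
    rewrite -(cardsID (section B a) B); congr (_ + _)%N.
    by apply: eq_card => b; rewrite !inE; case: (b \in B).
  rewrite /sparse -leqNgt in nsp.
  have q2 : (0 < 2 * q)%N by rewrite muln_gt0.
  have le1 : (2 * q * #|B :\: section B a| <= (2 * q).-1 * #|B|)%N.
    move: nsp q2; rewrite -SB; move: (2 * q)%N => w.
    by case: w => // w; nia.
  rewrite -(leq_pmul2l q2) -expnS; apply: leq_trans Bh.
  by rewrite mulnA expnS mulnA leq_mul2r (mulnC #|B|) le1 orbT.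
apply: (@leq_trans (#|B| * \sum_a
          (K ^ k * Q ^ h + sparse B a * (K ^ k * Q ^ h.+1)))%N).
  by rewrite leq_mul2l leq_sum ?orbT.
rewrite big_split /= sum_nat_const -big_distrl /= cV.
have -> : (\sum_a sparse B a)%N = #|[set a | sparse B a]|.
  rewrite -sum1_card [RHS]big_mkcond.
  by apply: eq_bigr => a _; rewrite inE; case: (sparse B a).
have BQ : (#|B| <= Q)%N by rewrite -cV max_card.
have := card_sparse B0; move: BQ.
rewrite [(K ^ k.+1)%N]expnS (expnS Q) {2}/K.
move: #|B| #|[set a | _]| (K ^ k)%N (Q ^ h)%N => Y N Kk Qh YQ NY.
(* The two summands are absorbed by the 1 and the [4 * q ^ 2] of [K]. *)
have -> : (Y * (Q * (Kk * Qh) + N * (Kk * (Q * Qh)))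
           = Y * (Q * Kk * Qh) + (N * Y) * (Kk * Q * Qh))%N by lia.
have -> : ((4 * q ^ 2 + 1) * Q * Kk * (Q * Qh)
           = Q * (Q * Kk * Qh) + (4 * q ^ 2 * Q) * (Kk * Q * Qh))%N by lia.
by apply: leq_add; rewrite leq_mul2r ?YQ ?NY orbT.
Qed.

(** Here [Q] is [2 ^ (j * m)], and every [2 * q] shrinkings halve the set, so [2 * q * (j * m)] of
    them suffice. *)
Lemma card_free_tuples_full j k :
  q = (2 ^ j)%N ->
  (#|free_tuples [set~ 0%R] k|
   <= ((4 * q ^ 2 + 1) * Q) ^ k * Q ^ (2 * q * (j * m)))%N.
Proof.
move=> qj; apply: card_free_tuples_le; first by rewrite !inE eqxx.
have cV : #|{: V}| = Q by rewrite card_mx mul1n.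
apply: (@leq_trans (Q * (2 * q).-1 ^ (2 * q * (j * m)))%N).
  by rewrite leq_mul2r -cV max_card orbT.
rewrite {1}qj -expnM !(expnM _ (2 * q)%N) -expnMn.
have [->|jm] := posnP (j * m)%N; first by rewrite !expn0.
by rewrite leq_exp2r // two_mul_pred_exp // muln_gt0 qj expn_gt0.
Qed.

(** * Vertex labels and the rank bound *)

Definition nonorth_pairs := [set x : V * V | dot x.1 x.2 != 0].

(** At least half of the vectors [b] are nonzero, and each of these is nonorthogonal to at least
    half of the [a]. *)
Lemma card_nonorth_pairs : (0 < m)%N -> (Q * Q <= 4 * #|nonorth_pairs|)%N.
Proof.
move=> m0; have cV : #|{: V}| = Q by rewrite card_mx mul1n.
have q1 : (1 < q)%N by exact: finNzRing_gt1.
have -> : #|nonorth_pairs| = (\sum_b #|~: orth b|)%N.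
  rewrite -sum1_card; under [RHS]eq_bigr do rewrite -sum1_card.
  rewrite (exchange_big_dep xpredT) //= pair_big_dep /=.
  by apply: eq_bigl => -[a b]; rewrite !inE.
rewrite (bigID (fun b => b == 0)) /=.
apply: (@leq_trans (4 * \sum_(b | b != 0%R) #|~: orth b|)%N); last first.
  by rewrite leq_mul2l leq_addl orbT.
have half b : b != 0 -> (Q <= 2 * #|~: orth b|)%N.
  move=> b0; have := card_orth b0; have := cardsC (orth b).
  rewrite cV; move: #|orth b| #|~: orth b| q1 Q => x y q1 z; nia.
have : (\sum_(b : V | b != 0%R) Q <= \sum_(b | b != 0%R) 2 * #|~: orth b|)%N.
  exact: leq_sum.
rewrite -big_distrr /= sum_nat_const.
have -> : #|(fun b => b != 0%R)| = Q.-1.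
  by rewrite -cV -(cardC1 (0 : V)); apply: eq_card => b; rewrite !inE.
have Q2 : (1 < Q)%N by rewrite -(exp1n m) ltn_exp2r.
move: (\sum_(b | _) _)%N Q2 => S; case: Q => // z; nia.
Qed.

(* If [v i] are pairs indexed by a clique listed in increasing order, the Gram
   matrix [dot (v i).1 (v j).2] is triangular with nonzero diagonal. *)
Lemma triangular_size p (v : 'I_p -> V * V) :
  (forall i, dot (v i).1 (v i).2 != 0) ->
  (forall i j : 'I_p, (i < j)%N -> dot (v i).1 (v j).2 = 0) -> (p <= m)%N.
Proof.
move=> diag upper.
pose A : 'M_(p, m) := \matrix_i (v i).1; pose C : 'M_(p, m) := \matrix_i (v i).2.
have ME i j : (A *m C^T) i j = dot (v i).1 (v j).2.
  by rewrite /dot !mxE; apply: eq_bigr => l _; rewrite !mxE.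
have trig : is_trig_mx (A *m C^T).
  by apply/is_trig_mxP => i j ij; rewrite ME upper.
have U : A *m C^T \in unitmx.
  rewrite unitmxE (det_trig trig) unitfE; apply/prodf_neq0 => i _.
  by rewrite ME diag.
by rewrite -(mxrank_unit U) mulmx_max_rank.
Qed.
End FiniteVectorSpace.

(** * The union bound *)

Lemma card_bigcup_le (I T : finType) (P : pred I) (S : I -> {set T}) :
  #|\bigcup_(i | P i) S i| <= \sum_(i | P i) #|S i|.
Proof.
elim/big_rec2: _ => [|i A n _ IH]; first by rewrite cards0.
by apply: leq_trans (leq_card_setU _ _) _; rewrite leq_add2l.
Qed.

(** The random labelling, as counting: there are at most [#|I| ^ k * #|G|] bad events, each of
    probability at most [#|P| ^ k] inverted. *)
Lemma exists_avoiding (I T : finType) (k : nat) (P : {set T})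
    (G : {set k.-tuple T}) :
  0 < #|P| -> #|I| ^ k * #|G| < #|P| ^ k ->
  exists f : {ffun I -> T}, (forall i, f i \in P) /\
    forall e : k.-tuple I, uniq e -> map_tuple f e \notin G.
Proof.
move=> P0 small; have /card_gt0P[x0 _] := P0.
pose S (e : k.-tuple I) (g : k.-tuple T) := [set f in ffun_on (mem P) | map_tuple f e == g].
(* The [k] distinct entries of [e] have forced values; multiplying by [#|P| ^ k] avoids a subtracted
   exponent. *)
have cardS (e : k.-tuple I) g : uniq e -> #|S e g| * #|P| ^ k <= #|P| ^ #|I|.
  move=> ue.
  pose D i : pred T :=
    if i \in e then pred1 (nth x0 g (index i e)) else mem P.
  have sD : S e g \subset family D.
    apply/subsetP => f; rewrite inE => /andP[/ffun_onP fP /eqP eg].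
    apply/familyP => i; rewrite /D -eg; case: ifP => [ie|_]; last exact: fP.
    by rewrite inE (nth_map i) ?index_mem // nth_index.
  have cD : #|family D| = #|P| ^ #|[predC e]|.
    rewrite card_family foldrE big_map big_enum /= (bigID (mem e)) /=.
    rewrite big1 ?mul1n => [|i ie]; last by rewrite /D ie card1.
    rewrite -prod_nat_const; apply: eq_bigr => i ie.
    by rewrite /D (negPf ie); apply: eq_card.
  rewrite -(cardC (mem e)) (card_uniqP ue) size_tuple addnC expnD leq_mul2r -cD.
  by rewrite subset_leq_card ?orbT.
pose good (f : {ffun I -> T}) :=
  [forall e : k.-tuple I, uniq e ==> (map_tuple f e \notin G)].
have [/exists_inP[f fP /forallP fG]|/exists_inPn none] :=
    boolP [exists f in ffun_on (mem P), good f].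
  exists f; split=> [|e]; first exact/ffun_onP.
  exact/implyP.
have cover : ffun_on (mem P) \subset
    \bigcup_(e : k.-tuple I | uniq e) \bigcup_(g in G) S e g.
  apply/subsetP => f fP; have := none f fP.
  rewrite negb_forall => /existsP[e]; rewrite negb_imply negbK => /andP[ue fG].
  apply/bigcupP; exists e => //; apply/bigcupP; exists (map_tuple f e) => //.
  by rewrite inE fP eqxx.
have := leq_mul (subset_leq_card cover) (leqnn (#|P| ^ k)).
rewrite card_ffun_on leqNgt => /negP[].
apply: (@leq_ltn_trans (#|I| ^ k * #|G| * #|P| ^ #|I|)); last first.
  by rewrite mulnC ltn_pmul2l // expn_gt0 P0.
rewrite -card_tuple -mulnA.
apply: (@leq_trans ((\sum_(e : k.-tuple I | uniq e) \sum_(g in G) #|S e g|)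
                    * #|P| ^ k)).
  rewrite leq_mul2r; apply/orP; right.
  apply: leq_trans (card_bigcup_le _ _) _; apply: leq_sum => e _.
  exact: card_bigcup_le.
apply: (@leq_trans (\sum_(e : k.-tuple I | uniq e) #|G| * #|P| ^ #|I|)).
  rewrite big_distrl; apply: leq_sum => e ue; rewrite big_distrl -sum_nat_const.
  by apply: leq_sum => g _; apply: cardS.
by rewrite sum_nat_const leq_mul2r max_card orbT.
Qed.

(** * From labels to a graph without large cliques or independent sets *)

Lemma pairwise_ltn_enum n (A : {set 'I_n}) :
  pairwise (fun i j : 'I_n => i < j) (enum A).
Proof.
have tr : transitive (fun i j : 'I_n => i < j) by move=> x y z; apply: ltn_trans.
rewrite -sorted_pairwise // /enum_mem sorted_filter //.
rewrite -enumT -[sorted _ _]/(sorted (relpre val ltn) _) -sorted_map.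
by rewrite val_enum_ord iota_ltn_sorted.
Qed.

Lemma ltn_nth_enum n (A : {set 'I_n}) x0 i j :
  i < j -> j < #|A| -> nth x0 (enum A) i < nth x0 (enum A) j.
Proof.
move=> ij jA; have /(pairwiseP x0) := pairwise_ltn_enum A; apply=> //.
  by rewrite inE -cardE (ltn_trans ij).
by rewrite inE -cardE.
Qed.

(** Since [h * D <= k], the factor [Q ^ h] costs at most the [D]-th root of [Q] per vertex; powers
    [D] keep this in integers. The 32 covers the density loss 4 times
    [4 * q ^ 2 + 1 <= 8 * q ^ 2]. *)
Lemma random_bound q Q D n k h W G :
  0 < Q -> 0 < k -> h * D <= k -> (n * (32 * q ^ 2)) ^ D * Q < Q ^ D ->
  0 < q -> Q * Q <= 4 * W -> G <= ((4 * q ^ 2 + 1) * Q) ^ k * Q ^ h ->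
  n ^ k * G < W ^ k.
Proof.
move=> Q0 k0 hD small q0 QW GQ.
have D0 : 0 < D by case: D small {hD} => //; rewrite !expn0; lia.
have t0 : 0 < q ^ 2 by rewrite expn_gt0 q0.
move: (q ^ 2) t0 small GQ => t t0 small GQ; set N := n * (32 * t) in small.
have NQ : N ^ k * Q ^ h < Q ^ k.
  rewrite -(ltn_exp2r _ _ D0) expnMn -!expnM (mulnC k) !expnM.
  apply: (@leq_ltn_trans ((N ^ D) ^ k * Q ^ k)).
    by rewrite leq_mul2l -(expnM Q) leq_pexp2l ?orbT.
  by rewrite -expnMn ltn_exp2r.
rewrite -(@ltn_pmul2l (4 ^ k)) ?expn_gt0 // -(expnMn 4 W).
apply: leq_trans (_ : (Q * Q) ^ k <= _); last by rewrite leq_exp2r.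
rewrite (expnMn Q); apply: leq_ltn_trans (_ : N ^ k * Q ^ h * Q ^ k < _); last first.
  by rewrite ltn_pmul2r ?expn_gt0 ?Q0.
apply: (@leq_trans (4 ^ k * (n ^ k * (((4 * t + 1) * Q) ^ k * Q ^ h)))).
  by rewrite !leq_mul2l GQ !orbT.
rewrite !mulnA (mulnAC (N ^ k)) leq_mul2r; apply/orP; right.
rewrite -!expnMn leq_exp2r // /N.
have -> : 4 * n * ((4 * t + 1) * Q) = n * Q * (4 * (4 * t + 1)) by lia.
have -> : n * (32 * t) * Q = n * Q * (32 * t) by lia.
by rewrite leq_mul2l; apply/orP; right; lia.
Qed.

Lemma not_ramsey_prop j m D n k :
  0 < j -> 0 < m -> 0 < k -> 2 * 2 ^ j * (j * m) * D <= k ->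
  (n * (32 * (2 ^ j) ^ 2)) ^ D * (2 ^ j) ^ m < ((2 ^ j) ^ m) ^ D ->
  ~ ramsey_prop m.+1 k n.
Proof.
move=> j0 m0 k0 kD small; have [F _ qj] := pPrimePowerField (erefl : prime 2) j0.
have Q0 : 0 < #|F| ^ m by rewrite qj !expn_gt0.
have WQ := card_nonorth_pairs F m0.
have W0 : 0 < #|nonorth_pairs F m|.
  by rewrite -(@ltn_pmul2l 4) // muln0; apply: leq_trans WQ; rewrite muln_gt0 Q0.
have cG := card_free_tuples_full m k qj.
rewrite -qj in kD small.
have q0 : 0 < #|F| by rewrite qj expn_gt0.
have := random_bound Q0 k0 kD small q0 WQ cG.
rewrite -[n in n ^ k]card_ord => /(exists_avoiding W0)[f [fP favoid]].
have fdiag i : dot (f i).1 (f i).2 != 0%R by have := fP i; rewrite inE.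
pose adj (i j : 'I_n) := (i < j) && (dot (f i).1 (f j).2 == 0%R).
pose E i j := adj i j || adj j i.
have Egraph : simple_graph E.
  split=> [x y|x]; first by rewrite /E orbC.
  by rewrite /E /adj ltnn.
case/(_ E Egraph) => -[A [cA HA]].
  have /card_gt0P[x0 _] : 0 < #|A| by rewrite cA.
  pose e (i : 'I_m.+1) := nth x0 (enum A) i.
  have eA i : e i \in A by rewrite -mem_enum mem_nth // -cardE cA.
  have : m.+1 <= m; last by rewrite ltnn.
  apply: (@triangular_size F m m.+1 (f \o e)) => [i|i l il] /=; first exact: fdiag.
  have lt : e i < e l by apply: ltn_nth_enum; rewrite ?cA.
  have := HA _ _ (eA i) (eA l); rewrite /E /adj lt (ltnNge (e l)) (ltnW lt) /= orbF.
  by move=> H; apply/eqP/H; rewrite -val_eqE neq_ltn lt.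
(* Listed in increasing order, an independent set would be labelled by a free sequence, which
   [favoid] excludes. *)
have /eqP sA : size (enum A) == k by rewrite -cardE cA.
have := favoid (tcast sA (in_tuple (enum A))).
rewrite val_tcast enum_uniq => /(_ isT)/negP; apply.
rewrite inE /= val_tcast /free_seq; apply/andP; split.
  apply/allP => _ /mapP[i _ ->]; rewrite !inE.
  by apply: contraNneq (fdiag i) => ->; rewrite dot0r.
rewrite pairwise_map.
apply: (@sub_in_pairwise _ (mem A)) (pairwise_ltn_enum A).
  move=> x y xA yA xy /=.
  have := HA x y xA yA; rewrite /E negb_or => /andP[+ _].
  by rewrite /adj xy.
by apply/allP => x; rewrite mem_enum.
Qed.

(* Logarithmic estimates over the reals *)
From Stdlib Require Import Reals Lra.
(* Reals takes over the key %N and the notation ^ on nat; this restores them. *)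
From mathcomp Require Import ssrnat.
Local Open Scope R_scope.

Lemma INR_muln a b : INR (a * b)%N = INR a * INR b.
Proof. exact: mult_INR. Qed.

Lemma INR_expn a b : INR (a ^ b)%N = INR a ^ b.
Proof. by elim: b => [|b IH] //; rewrite expnS INR_muln IH. Qed.

Lemma INR_leq a b : (a <= b)%N -> INR a <= INR b.
Proof. by move/leP/le_INR. Qed.

Lemma leq_INR a b : INR a <= INR b -> (a <= b)%N.
Proof. by move/INR_le/leP. Qed.

Lemma ltn_INR a b : INR a < INR b -> (a < b)%N.
Proof. by move/INR_lt/ltP. Qed.

Lemma ln_le x y : 0 < x -> x <= y -> ln x <= ln y.
Proof. by move=> x0 [/(ln_increasing _ _ x0)/Rlt_le|->] //; apply: Rle_refl. Qed.

(** For [t = j * ln 2 / D], [exp t] is at least the square of [t / 2], hence at least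
    [j ^ 2 / (16 * D ^ 2)] because [ln 2] exceeds 1/2; this is where 128 comes from. *)
Lemma ln_linear_le D j :
  1 <= D -> 128 * D ^ 3 <= j -> D * ln (8 * D * j) <= j * ln 2.
Proof.
move=> D1 jD; have l2 := ln_lt_2; have D3 : 1 <= D ^ 3 by apply: pow_R1_Rle.
have t0 : 0 < j * ln 2 / D.
  by apply: Rdiv_lt_0_compat; [apply: Rmult_lt_0_compat|]; lra.
set t := j * ln 2 / D in t0.
suff lnt : ln (8 * D * j) <= t.
  have -> : j * ln 2 = D * t by rewrite /t; field; lra.
  by apply: Rmult_le_compat_l; lra.
rewrite -[t]ln_exp; apply: ln_le; first by apply: Rmult_lt_0_compat; lra.
have -> : exp t = exp (t / 2) * exp (t / 2) by rewrite -exp_plus; congr exp; field.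
have et : t / 2 <= exp (t / 2) by have := exp_ineq1_le (t / 2); lra.
apply: (Rle_trans _ (t / 2 * (t / 2))); last by apply: Rmult_le_compat; lra.
have jl : 32 * D ^ 3 <= j * (ln 2 * ln 2).
  have l4 : / 4 <= ln 2 * ln 2 by nra.
  have : j * / 4 <= j * (ln 2 * ln 2) by apply: Rmult_le_compat_l; lra.
  lra.
have -> : t / 2 * (t / 2) = j * (j * (ln 2 * ln 2)) / (4 * D ^ 2).
  by rewrite /t; field; lra.
have -> : 8 * D * j = j * (32 * D ^ 3) / (4 * D ^ 2) by field; lra.
apply: Rmult_le_compat_r; first by apply/Rlt_le/Rinv_0_lt_compat; nra.
by apply: Rmult_le_compat_l; lra.
Qed.

(** After dividing by [j * y], the gain [d * s * D] must beat [(1 - d) * s + s - 1 + 8 * D]. Half of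
    it is at least [2 * s] as [4 <= d * D], the other half at least [8 * D] as [16 <= d * s]. *)
Lemma exponent_bound d D s j X y :
  0 < d <= / 2 -> 4 / d <= D -> 16 / d <= s -> 1 <= j -> 0 < y ->
  0 <= X -> D * X <= D * (j * y) + j * y ->
  D * ((1 - d) * s * X + 5 * y + 2 * (j * y)) + (s - 1) * (j * y)
  < D * ((s - 1) * (j * y)).
Proof.
move=> [d0 d2] Dd sd j1 y0 X0 XD.
have dD : 4 <= d * D.
  by apply: (Rmult_le_reg_l (/ d)); [exact: Rinv_0_lt_compat|]; field_simplify; lra.
have ds : 16 <= d * s.
  by apply: (Rmult_le_reg_l (/ d)); [exact: Rinv_0_lt_compat|]; field_simplify; lra.
have D0 : 0 < D by nra.
have s0 : 0 < s by nra.
set Y := j * y in XD *.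
have yY : y <= Y by rewrite /Y; nra.
have e1 : (1 - d) * s * (D * X) <= (1 - d) * s * (D * Y + Y).
  by apply: Rmult_le_compat_l XD; nra.
suff : (1 - d) * s * (D * Y + Y) + D * (7 * Y) + (s - 1) * Y < D * ((s - 1) * Y).
  by nra.
suff : (1 - d) * s * (D + 1) + D * 7 + (s - 1) < D * (s - 1) by nra.
nra.
Qed.

Lemma small_graph_bound d x D j m r :
  0 < d <= / 2 -> 4 / d <= INR D -> 16 / d <= INR m.+1 ->
  (128 * D ^ 3 <= j)%N -> 1 <= x -> x < INR (2 * 2 ^ j.+1 * j.+1 * D) ->
  INR r < Rpower x ((1 - d) * INR m.+1) ->
  ((r * (32 * (2 ^ j) ^ 2)) ^ D * (2 ^ j) ^ m < ((2 ^ j) ^ m) ^ D)%N.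
Proof.
move=> hd hD hs hj x1 xj hr.
have D1 : (1 <= D)%N.
  rewrite lt0n; apply/eqP => D0; move: hD; rewrite D0 /=.
  have : 0 < 4 / d by apply: Rdiv_lt_0_compat; lra.
  lra.
have rD1 : 1 <= INR D by exact: (INR_leq D1).
have j1 : (1 <= j)%N by apply: leq_trans hj; rewrite muln_gt0 expn_gt0 D1.
have rj1 : 1 <= INR j by exact: (INR_leq j1).
have [->|r0] := posnP r.
  by rewrite mul0n exp0n // mul0n !expn_gt0.
have rr0 : 0 < INR r by apply/lt_0_INR/ltP.
apply: ltn_INR.
have E2 : INR 2 = 2 by [].
have E32 : INR 32 = 2 ^ 5 by rewrite INR_IZR_INZ /=; lra.
rewrite INR_muln !INR_expn (INR_muln r) (INR_muln 32) !INR_expn E2 E32.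
have p2 i : 0 < 2 ^ i by apply: pow_lt; lra.
have pp i l : 0 < (2 ^ i) ^ l by apply: pow_lt.
have base : 0 < INR r * (2 ^ 5 * (2 ^ j) ^ 2).
  by apply: Rmult_lt_0_compat => //; apply: Rmult_lt_0_compat => //; lra.
have baseD := pow_lt _ D base; have p5 : 0 < 2 ^ 5 by apply: pow_lt; lra.
have two0 : 0 < 2 by lra.
apply: ln_lt_inv; [exact: Rmult_lt_0_compat|exact: pow_lt|].
rewrite ln_mult // ln_pow // ln_mult //; last exact: Rmult_lt_0_compat.
rewrite ln_mult // !ln_pow //.
have lnr : ln (INR r) <= (1 - d) * INR m.+1 * ln x.
  by apply/Rlt_le; rewrite -[X in _ < X]ln_exp; apply: ln_increasing.
have l2 := ln_lt_2.
have lx0 : 0 <= ln x by rewrite -ln_1; apply: ln_le; lra.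
(* Uses [j + 1 <= 2 * j]; [ln_linear_le] then makes the first logarithm a 1/D fraction of the
   second. *)
have lnx : ln x <= ln (8 * INR D * INR j) + INR j * ln 2.
  rewrite -ln_pow; last lra.
  rewrite -ln_mult //; last by apply: Rmult_lt_0_compat; lra.
  apply: ln_le; first lra.
  apply: Rlt_le; apply: Rlt_le_trans xj _.
  rewrite !INR_muln INR_expn E2 S_INR /=.
  have := p2 j; move: (2 ^ j) => u u0; have : 0 < INR D * u by nra.
  nra.
have hj' : 128 * INR D ^ 3 <= INR j.
  move: (INR_leq hj); rewrite INR_muln INR_expn.
  by rewrite (INR_IZR_INZ 128).
have lin := ln_linear_le rD1 hj'.
have key : INR D * ln x <= INR D * (INR j * ln 2) + INR j * ln 2 by nra.
have l0 : 0 < ln 2 by lra.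
have := exponent_bound hd hD hs rj1 l0 lx0 key.
have -> : INR m.+1 - 1 = INR m by rewrite S_INR; lra.
have -> : INR 5 = 5 by rewrite INR_IZR_INZ.
rewrite E2; nra.
Qed.

(** * Choice of the field size and of the constant *)

Theorem theorem1p3 :
  forall delta : R, (0 < delta)%R ->
  exists L : R,
    forall s k : nat, (0 < s)%N -> (L <= INR s)%R -> (L * INR s <= INR k)%R ->
    forall r : nat, is_ramsey_number s k r ->
      (Rpower (INR k / INR s) ((1 - delta) * INR s) <= INR r)%R.
Proof.
(* The cap keeps [1 - d] positive; as [k / s] is at least 1, the bound for [d] implies the one for
   [delta]. *)
move=> delta delta0; pose d := Rmin delta (/ 2).
have hd : 0 < d <= / 2 by split; [apply: Rmin_glb_lt; lra|exact: Rmin_r].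
have [D /Rlt_le hD] : exists D, 4 / d < INR D by exact: INR_unbounded.
(* [j0] is the threshold of [ln_linear_le]; [c j * s <= k] lets the field of size [2 ^ j] be
   used. *)
pose j0 := (128 * D ^ 3)%N; pose c j := (2 * 2 ^ j * j * D)%N.
exists (16 / d + INR (c j0) + 1) => s k s0 Ls Lk r [ramsey _].
have d16 : 32 <= 16 / d.
  apply: (Rmult_le_reg_r d); first lra.
  by field_simplify; lra.
have c0 := pos_INR (c j0).
have rs0 : 0 < INR s by apply/lt_0_INR/ltP.
have x1 : 1 <= INR k / INR s.
  by apply: (Rmult_le_reg_r (INR s)) => //; field_simplify; nra.
apply: (Rle_trans _ (Rpower (INR k / INR s) ((1 - d) * INR s))).
  have : d <= delta by exact: Rmin_l.
  move=> dd; have [->|x1'] : INR k / INR s = 1 \/ 1 < INR k / INR s by lra.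
    by rewrite /Rpower ln_1 !Rmult_0_r; lra.
  by apply: Rle_Rpower; nra.
(* Otherwise [r] is small enough for a graph on [r] vertices to refute [ramsey]. *)
apply: Rnot_lt_le => hr.
have cj0 : (c j0 * s <= k)%N by apply: leq_INR; rewrite INR_muln; nra.
have D1 : (0 < D)%N.
  apply/ltP/INR_lt; apply: Rlt_le_trans hD; rewrite /=.
  by apply: Rdiv_lt_0_compat; lra.
(* The largest admissible [j], which exists since [j <= c j]; maximality puts [2 ^ j] within a
   factor of order [j * D] of [k / s]. *)
have [j [jj0 cj cj1]] : exists j, [/\ j0 <= j, c j * s <= k & k < c j.+1 * s]%N.
  have bnd j : (c j * s <= k)%N -> (j <= k)%N.
    apply: leq_trans; rewrite /c.
    rewrite -[leqLHS]mul1n -[leqLHS]muln1 -[leqLHS]muln1 leq_mul // leq_mul // leq_mul //.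
    by rewrite muln_gt0 expn_gt0.
  case: (ex_maxnP (ex_intro _ j0 cj0) bnd) => j cj jmax; exists j; split=> //.
    exact: jmax.
  by rewrite ltnNge; apply/negP => /jmax; rewrite ltnn.
case: s s0 Ls Lk rs0 x1 hr ramsey cj0 cj cj1 => // m _ Ls Lk rs0 x1 hr ramsey cj0 cj cj1.
have j1 : (0 < j)%N by apply: leq_trans jj0; rewrite muln_gt0 expn_gt0 D1.
have m1 : (0 < m)%N.
  by rewrite lt0n; apply/eqP => m0; move: Ls; rewrite m0 /=; lra.
have k1 : (0 < k)%N.
  by apply: leq_trans cj; rewrite !muln_gt0 expn_gt0 j1 D1.
apply: (@not_ramsey_prop j m D r k) ramsey => //.
  by apply: leq_trans cj; rewrite /c; nia.
apply: (@small_graph_bound d (INR k / INR m.+1)) => //; first by lra.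
apply: (Rmult_lt_reg_r (INR m.+1)) => //.
rewrite -INR_muln; field_simplify; last lra.
exact/lt_INR/ltP.
Qed.
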